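(* Fix $\beta\in\mathbb{R}$. For each $N\in\mathbb{N}$ let $G_N$ be a graph on $N$ vertices, and suppose the sequence $\{G_N\}_{N\in\mathbb{N}}$ has uniformly bounded average degree, that is, $$\sup_{N\ge1}\frac1N\sum_{u=1}^N d_u(G_N)<\infty.$$ Let $\vec\sigma\sim\mathbb{P}^N_\beta$ be a sample from the hardcore model on $G_N$. Then the MPL estimate $\hat\beta^N(\vec\sigma)=\log\big(c^N(\vec\sigma)/u^N(\vec\sigma)\big)$ is $\sqrt N$-consistent for $\beta$, that is, $$\lim_{M\to\infty}\limsup_{N\to\infty}\mathbb{P}^N_\beta\big(\sqrt N\,|\hat\beta^N(\vec\sigma)-\beta|>M\big)=0.$$
   Context: Each $G_N$ is a finite simple graph with vertex set $[N]=\{1,\dots,N\}$ and edge set $E(G_N)$, with no isolated vertices; $\mathcal{N}_{G_N}(u)$ is the set of neighbors of $u$ and $d_u(G_N)=|\mathcal{N}_{G_N}(u)|$. The hardcore model with parameter $\beta\in\mathbb{R}$ is the probability measure on $\{0,1\}^N$ $$\mathbb{P}^N_\beta(\vec\sigma)=\frac{e^{\beta\sum_{u=1}^N\sigma_u}\prod_{(u,v)\in E(G_N)}(1-\sigma_u\sigma_v)}{Z_{G_N}(e^\beta)},$$ with $Z_{G_N}(e^\beta)$ the normalizing constant. Write $c^N(\vec\sigma)=|\{u:\sigma_u=1\}|$ and $u^N(\vec\sigma)=|\{u:\sigma_u=0\text{ and }\sigma_v=0\ \forall v\in\mathcal{N}_{G_N}(u)\}|$. The quantity $\log(c^N/u^N)$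 is read as an extended real: $-\infty$ if $c^N=0$, $+\infty$ if $u^N=0$. *)

(* Defs.v *)
From mathcomp Require Export all_boot all_order all_algebra.
From mathcomp Require Export all_classical all_reals all_analysis.
Export Order.TTheory GRing.Theory Num.Theory.
Export numFieldNormedType.Exports.

Set Implicit Arguments.
Unset Strict Implicit.
Unset Printing Implicit Defensive.

Local Open Scope ring_scope.

Record sgraph (T : finType) := SGraph {
  adj : rel T;
  adj_sym : symmetric adj;
  adj_irrefl : irreflexive adj }.

Definition neighbors (T : finType) (G : sgraph T) (u : T) : {set T} :=
  [set v | adj G u v]%SET.

Definition degree (T : finType) (G : sgraph T) (u : T) : nat :=
  #|neighbors G u|.

Definition no_isolated (T : finType) (G : sgraph T) : Prop :=
  forall u, (0 < degree G u)%N.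

Definition avg_degree (R : realType) (N : nat) (G : sgraph 'I_N) : R :=
  (N%:R)^-1 * \sum_(u < N) (degree G u)%:R.

Definition config (N : nat) := {ffun 'I_N -> bool}.

(* Each undirected edge is counted once, as the pair (u, v) with u < v. *)
Definition hardcore_weight (R : realType) (beta : R) (N : nat)
    (G : sgraph 'I_N) (s : config N) : R :=
  expR (beta * \sum_(u < N) (s u)%:R) *
  \prod_(u < N) \prod_(v < N | (u < v)%N && adj G u v)
    (1 - (s u)%:R * (s v)%:R).

Definition hardcore_Z (R : realType) (beta : R) (N : nat)
    (G : sgraph 'I_N) : R :=
  \sum_(s : config N) hardcore_weight beta G s.

Definition hardcore_pmf (R : realType) (beta : R) (N : nat)
    (G : sgraph 'I_N) (s : config N) : R :=
  hardcore_weight beta G s / hardcore_Z beta G.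

Definition hardcore_prob (R : realType) (beta : R) (N : nat)
    (G : sgraph 'I_N) (A : pred (config N)) : R :=
  \sum_(s : config N | A s) hardcore_pmf beta G s.

Definition occupied (N : nat) (s : config N) : nat :=
  #|[set u : 'I_N | s u]%SET|.

Definition unblocked (N : nat) (G : sgraph 'I_N) (s : config N) : nat :=
  #|[set u : 'I_N | ~~ s u & [forall v in neighbors G u, ~~ s v]]%SET|.

(* For N > 0 the two degenerate cases exclude each other: if no vertex is
   occupied, then all N vertices are unblocked. *)
Definition mple (R : realType) (N : nat) (G : sgraph 'I_N)
    (s : config N) : \bar R :=
  if occupied s == 0%N then -oo%E
  else if unblocked G s == 0%N then +oo%E
  else (ln ((occupied s)%:R / (unblocked G s)%:R))%:E.

Lemma hardcore_weight_ge0 (R : realType) (beta : R) (N : nat)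
    (G : sgraph 'I_N) (s : config N) : 0 <= hardcore_weight beta G s.
Proof.
rewrite mulr_ge0 ?expR_ge0 //; apply: prodr_ge0 => u _.
by apply: prodr_ge0 => v _; case: (s u); case: (s v);
  rewrite ?mulr1 ?mulr0 ?subrr ?subr0 ?mul0r ?subr0.
Qed.

Lemma hardcore_Z_gt0 (R : realType) (beta : R) (N : nat)
    (G : sgraph 'I_N) : 0 < hardcore_Z beta G.
Proof.
rewrite /hardcore_Z (bigD1 [ffun=> false]) //= ltr_pwDl //; last first.
  by apply: sumr_ge0 => s _; exact: hardcore_weight_ge0.
rewrite mulr_gt0 ?expR_gt0 // big1 // => u _.
by rewrite big1 // => v _; rewrite !ffunE mul0r subr0.
Qed.

Lemma hardcore_pmf_ge0 (R : realType) (beta : R) (N : nat)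
    (G : sgraph 'I_N) (s : config N) : 0 <= hardcore_pmf beta G s.
Proof. by rewrite divr_ge0 ?hardcore_weight_ge0 // ltW ?hardcore_Z_gt0. Qed.

Lemma hardcore_prob_total (R : realType) (beta : R) (N : nat)
    (G : sgraph 'I_N) : hardcore_prob beta G predT = 1.
Proof. by rewrite /hardcore_prob -mulr_suml divff // gt_eqF ?hardcore_Z_gt0. Qed.

(* Main.v *)
(* Write t = e^beta, c and U for the numbers of occupied and unblocked vertices.
   Conditionally on the other spins, an available vertex u is occupied with
   probability t / (1 + t), so Y_u = s_u - t * [u unblocked] is centred given
   the spins off u; since Y_v does not depend on s_u when u and v are distinct
   and non-adjacent, E[(c - t U)^2] = E[(\sum_u Y_u)^2] = O(N) as soon as the
   average degree is bounded. Moreover Z grows exponentially in N, as G_N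
   contains an independent set of linear size, so a Chernoff bound gives
   c >= delta * N outside an event of exponentially small probability. On the
   remaining event both c and t U are of order N and differ by O(sqrt N), hence
   ln (c / U) - beta = ln c - ln (t U) = O(1 / sqrt N). *)
From mathcomp Require Import ring lra.
Require Import Defs.

Set Implicit Arguments.
Unset Strict Implicit.
Unset Printing Implicit Defensive.

Local Open Scope classical_set_scope.
Local Open Scope ring_scope.

(** * Independent sets as the support of the hardcore weight *)

Definition independent (N : nat) (G : sgraph 'I_N) (s : config N) : bool :=
  [forall u, s u ==> [forall v in neighbors G u, ~~ s v]].

Lemma independentP (N : nat) (G : sgraph 'I_N) (s : config N) :
  reflect (forall u v, adj G u v -> s u -> s v -> False) (independent G s).
Proof.
apply: (iffP forallP) => [H u v uv su sv|H u].
  have /implyP/(_ su)/forall_inP/(_ v) := H u.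
  by rewrite inE => /(_ uv); rewrite sv.
apply/implyP => su; apply/forall_inP => v; rewrite inE => uv.
by apply/negP => /(H u v uv su).
Qed.

Lemma occupiedE (R : realType) (N : nat) (s : config N) :
  (occupied s)%:R = \sum_(u < N) (s u)%:R :> R.
Proof.
rewrite /occupied -sum1_card natr_sum big_mkcond /=.
by apply: eq_bigr => u _; rewrite inE; case: (s u).
Qed.

Lemma hardcore_weightE (R : realType) (beta : R) (N : nat) (G : sgraph 'I_N)
    (s : config N) :
  hardcore_weight beta G s
  = expR (beta * (occupied s)%:R) * (independent G s)%:R.
Proof.
rewrite /hardcore_weight occupiedE; congr (_ * _).
have [/independentP H|] := boolP (independent G s).
  apply: big1 => u _; apply: big1 => v /andP[_ uv].
  by have := H u v uv; case: (s u); case: (s v);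
    rewrite ?mulr0 ?mul0r ?subr0 // => /(_ erefl erefl).
move=> /forallPn[u]; rewrite negb_imply => /andP[su /forall_inPn[v]].
rewrite inE negbK => uv sv.
(* The weight lists each edge with its smaller endpoint first, so the violated edge has to be
   oriented before its vanishing factor can be named. *)
wlog uv_lt : u v uv su sv / (u < v)%N => [hw|].
  have := ltngtP u v; case=> [/hw|/hw|/val_inj E]; first exact.
    by apply; rewrite // adj_sym.
  by rewrite E adj_irrefl in uv.
apply/eqP/prodf_eq0; exists u => //; apply/prodf_eq0; exists v.
  by rewrite uv_lt.
by rewrite su sv mulr1 subrr.
Qed.

(** * Spin flips and the second moment of the score *)

Definition toggle (N : nat) (u : 'I_N) (s : config N) : config N :=
  [ffun v => if v == u then ~~ s v else s v].

Lemma toggleK (N : nat) (u : 'I_N) : involutive (toggle u).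
Proof.
by move=> s; apply/ffunP => v; rewrite !ffunE; case: eqP => // _; rewrite negbK.
Qed.

Definition score (R : realType) (beta : R) (N : nat) (G : sgraph 'I_N)
    (u : 'I_N) (s : config N) : R :=
  (s u)%:R
  - expR beta * (~~ s u && [forall v in neighbors G u, ~~ s v])%:R.

Lemma sum_score (R : realType) (beta : R) (N : nat) (G : sgraph 'I_N)
    (s : config N) :
  \sum_(u < N) score beta G u s
  = (occupied s)%:R - expR beta * (unblocked G s)%:R.
Proof.
rewrite big_split /= -occupiedE sumrN -mulr_sumr; congr (_ - _ * _).
rewrite /unblocked -sum1_card natr_sum [RHS]big_mkcond /=.
by apply: eq_bigr => u _; rewrite inE; case: ifP.
Qed.

Lemma score_norm_le (R : realType) (beta : R) (N : nat) (G : sgraph 'I_N)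
    (u : 'I_N) (s : config N) : `|score beta G u s| <= 1 + expR beta.
Proof.
rewrite /score; have := expR_gt0 beta; set t := expR beta => t0.
by case: (s u) => /=; [|case: [forall _ in _, _]];
  rewrite ?mulr1 ?mulr0 ler_norml; apply/andP; split; lra.
Qed.

(** Occupying [u] multiplies the exponential factor by t and keeps independence exactly when no
    neighbour of [u] is occupied. This matches the factor -t and the unblocked indicator in the
    score of the flipped configuration. *)
Lemma weight_score_occupied (R : realType) (beta : R) (N : nat)
    (G : sgraph 'I_N) (u : 'I_N) (s : config N) : s u ->
  hardcore_weight beta G (toggle u s) * score beta G u (toggle u s)
  = - (hardcore_weight beta G s * score beta G u s).
Proof.
move=> su; set s' := toggle u s.
have s'u : s' u = false by rewrite ffunE eqxx su.
have s'E v : v != u -> s' v = s v by rewrite ffunE => /negPf->.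
rewrite !hardcore_weightE /score su s'u /= !occupiedE.
rewrite [in RHS](bigD1 u) //= [in LHS](bigD1 u) //= su s'u.
rewrite (eq_bigr (fun v => (s v)%:R)) => [|v /s'E-> //].
rewrite mulr0n mulr1n !mulrDr !expRD !mulr0 expR0 !mulr1 !mul1r.
set A := [forall v in neighbors G u, ~~ s' v].
have -> : independent G s = A && independent G s'.
  apply/independentP/andP => [H|[/forall_inP HA /independentP H] v w vw sv sw].
    split.
      apply/forall_inP => v; rewrite inE => uv; apply/negP.
      rewrite s'E; first exact: H uv su.
      by apply/negP => /eqP vu; rewrite vu adj_irrefl in uv.
    apply/independentP => v w vw.
    have [->|vu] := eqVneq v u; first by rewrite s'u.
    have [->|wu] := eqVneq w u; first by rewrite s'u.
    by rewrite !s'E //; exact: H.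
  have [vu|vu] := eqVneq v u.
    have := HA w; rewrite inE -vu => /(_ vw); rewrite s'E ?sw //.
    by apply/negP => /eqP wu; rewrite vu wu adj_irrefl in vw.
  have [wu|wu] := eqVneq w u.
    by have := HA v; rewrite inE -wu adj_sym => /(_ vw); rewrite s'E ?sv //.
  by apply: (H v w vw); rewrite s'E.
by case: A; case: (independent G s') => /=; ring.
Qed.

(* The heat-bath identity E[Y_u | s off u] = 0, in pairing form. *)
Lemma weight_score_toggle (R : realType) (beta : R) (N : nat)
    (G : sgraph 'I_N) (u : 'I_N) (s : config N) :
  hardcore_weight beta G (toggle u s) * score beta G u (toggle u s)
  = - (hardcore_weight beta G s * score beta G u s).
Proof.
have [su|su] := boolP (s u); first exact: weight_score_occupied.
have su' : toggle u s u by rewrite ffunE eqxx.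
by rewrite -[in RHS](toggleK u s) (weight_score_occupied _ _ su') opprK.
Qed.

Lemma score_toggle_far (R : realType) (beta : R) (N : nat) (G : sgraph 'I_N)
    (u v : 'I_N) (s : config N) : v != u -> ~~ adj G u v ->
  score beta G v (toggle u s) = score beta G v s.
Proof.
move=> vu nuv; rewrite /score !ffunE (negPf vu).
do 4!congr (_ _ _); congr (_ && _); apply/eq_forallb_in => w.
rewrite inE ffunE => vw; case: eqP => // wu.
by rewrite -wu adj_sym vw in nuv.
Qed.

(** Flipping [u] is an involution that negates weight times score at [u] and fixes the score at [v],
    so the sum equals its own opposite. *)
Lemma score_uncorrelated (R : realType) (beta : R) (N : nat) (G : sgraph 'I_N)
    (u v : 'I_N) : v != u -> ~~ adj G u v ->
  \sum_(s : config N)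
    hardcore_weight beta G s * score beta G u s * score beta G v s = 0.
Proof.
move=> vu nuv; set S := (LHS).
suff : S = - S by move=> /eqP; lra.
rewrite {1}/S (reindex_inj (inv_inj (@toggleK N u))) /= -sumrN.
apply: eq_bigr => s _.
by rewrite weight_score_toggle score_toggle_far // mulNr.
Qed.

(** Serves two counts: the correlated pairs in the second moment, and the vertices dominated by an
    independent set. *)
Lemma closed_degreeE (R : realType) (N : nat) (G : sgraph 'I_N) (u : 'I_N) :
  1 + (degree G u)%:R = \sum_(v < N) ((v == u) || adj G u v)%:R :> R.
Proof.
rewrite (bigD1 u) //= eqxx /= /degree -sum1_card natr_sum; congr (1 + _).
rewrite big_mkcond [RHS]big_mkcond /=; apply: eq_bigr => v _.
by rewrite inE; case: eqVneq => [->|_]; rewrite ?adj_irrefl //=; case: ifP.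
Qed.

(** In the expanded square only equal or adjacent pairs survive, and each contributes at most (1 +
    t)^2 Z. *)
Lemma sum_score_sq (R : realType) (beta : R) (N : nat) (G : sgraph 'I_N) :
  \sum_(s : config N)
    hardcore_weight beta G s * (\sum_(u < N) score beta G u s) ^+ 2
  <= (1 + expR beta) ^+ 2 * hardcore_Z beta G
     * \sum_(u < N) (1 + (degree G u)%:R).
Proof.
have -> : \sum_(s : config N)
    hardcore_weight beta G s * (\sum_(u < N) score beta G u s) ^+ 2
  = \sum_(u < N) \sum_(v < N) \sum_(s : config N)
    hardcore_weight beta G s * score beta G u s * score beta G v s.
  under eq_bigr => s _.
    rewrite expr2 big_distrlr /= mulr_sumr.
    under eq_bigr => u _.
      rewrite mulr_sumr; under eq_bigr do rewrite mulrA.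
      over.
    over.
  rewrite exchange_big; apply: eq_bigr => u _.
  by rewrite exchange_big.
rewrite mulr_sumr; apply: ler_sum => u _.
rewrite closed_degreeE mulr_sumr; apply: ler_sum => v _.
have [_|] := boolP ((v == u) || adj G u v); last first.
  by rewrite negb_or => /andP[vu uv]; rewrite score_uncorrelated ?mulr0.
rewrite mulr1 mulr_sumr; apply: ler_sum => s _.
rewrite -mulrA mulrC; apply: ler_wpM2r; first exact: hardcore_weight_ge0.
apply: le_trans (ler_norm _) _; rewrite normrM expr2.
by apply: ler_pM => //; exact: score_norm_le.
Qed.

(** * Bounds on the partition function and a large independent set *)

(** Without the independence constraint the sum factorizes into (1 + t)^N. *)
Lemma hardcore_Z_le (R : realType) (beta : R) (N : nat) (G : sgraph 'I_N) :
  hardcore_Z beta G <= expR (N%:R * expR beta).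
Proof.
have prodE : \prod_(u < N) \sum_(b : bool) expR (beta * b%:R)
    = (1 + expR beta) ^+ N.
  by rewrite prodr_const card_ord big_bool /= mulr1 mulr0 expR0 addrC.
apply: (@le_trans _ _ ((1 + expR beta) ^+ N)); last first.
  by rewrite expRM_natl lerXn2r ?nnegrE ?expR_ge0 ?addr_ge0 ?expR_ge0 ?expR_ge1Dx.
rewrite -prodE bigA_distr_bigA; apply: ler_sum => s _.
rewrite hardcore_weightE occupiedE mulr_sumr expR_sum ler_piMr//.
  by rewrite prodr_ge0 // => u _; exact: expR_ge0.
by case: independent.
Qed.

Lemma hardcore_Z_ge (R : realType) (beta : R) (N : nat) (G : sgraph 'I_N)
    (I : {set 'I_N}) : {in I &, forall u v, ~~ adj G u v} ->
  (1 + expR beta) ^+ #|I| <= hardcore_Z beta G.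
Proof.
move=> indI.
(* [F] forces the spins off [I] to be 0, so the expanded product runs over the subsets of [I], all
   of them independent. *)
pose F (u : 'I_N) (b : bool) : R :=
  if u \in I then expR (beta * b%:R) else (~~ b)%:R.
have -> : (1 + expR beta) ^+ #|I| = \prod_(u < N) \sum_(b : bool) F u b.
  rewrite -prodr_const big_mkcond; apply: eq_bigr => u _.
  rewrite big_bool /F; case: ifP => _; last by rewrite /= add0r.
  by rewrite mulr1 mulr0 expR0 addrC.
rewrite bigA_distr_bigA; apply: ler_sum => s _.
have [sI|] := boolP [forall u, s u ==> (u \in I)]; last first.
  move=> /forallPn[u]; rewrite negb_imply => /andP[su uI].
  by rewrite (bigD1 u)//= /F (negPf uI) su mul0r hardcore_weight_ge0.
have {}sI u : s u -> u \in I by move/forallP: sI => /(_ u)/implyP.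
have ind : independent G s.
  apply/independentP => u v uv su sv.
  by have := indI u v (sI _ su) (sI _ sv); rewrite uv.
rewrite hardcore_weightE ind mulr1 occupiedE mulr_sumr expR_sum.
apply: ler_prod => u _; rewrite /F; case: ifP => [_|uI].
  by rewrite expR_ge0 lexx.
have -> : s u = false by apply/negP => /sI; rewrite uI.
by rewrite mulr0 expR0 ler01 lexx.
Qed.

(* By Markov's inequality at least half of the vertices have degree at most
   twice the average bound; a maximal independent subset of these dominates
   them. *)
Lemma large_independent_set (R : realType) (N : nat) (G : sgraph 'I_N)
    (D : R) : 0 < D -> \sum_(u < N) (degree G u)%:R <= N%:R * D ->
  exists2 I : {set 'I_N}, {in I &, forall u v, ~~ adj G u v} &
    N%:R <= #|I|%:R * (2 * (1 + 2 * D)).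
Proof.
move=> D0 sumD.
pose L := [set u | (degree G u)%:R <= 2 * D]%SET.
pose indep (I : {set 'I_N}) :=
  (I \subset L) && [forall u in I, forall v in I, ~~ adj G u v].
have L_half : N%:R <= 2 * #|L|%:R :> R.
  have : N%:R = \sum_(u < N) 1 :> R by rewrite sumr_const card_ord.
  have cardL : #|L|%:R = \sum_(u < N) (u \in L)%:R :> R.
    by rewrite -sum1_card natr_sum big_mkcond; apply: eq_bigr => u _; case: ifP.
  have : \sum_(u < N) (1 - (u \in L)%:R) * (2 * D)
      <= \sum_(u < N) (degree G u)%:R :> R.
    apply: ler_sum => u _; rewrite inE; case: (leP _ (2 * D)) => [_|/ltW].
      by rewrite subrr mul0r.
    by rewrite subr0 mul1r.
  rewrite -mulr_suml sumrB -cardL sumr_const card_ord => h _.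
  have : (N%:R - #|L|%:R) * (2 * D) <= N%:R * D by exact: le_trans h sumD.
  by nra.
have [I] : {I | maxset indep I}.
  apply: ex_maxset; exists finset.set0; rewrite /indep finset.sub0set /=.
  by apply/forall_inP => u; rewrite inE.
move=> /maxsetP[/andP[IL /forall_inP indI] maxI].
have {}indI u v : u \in I -> v \in I -> ~~ adj G u v.
  by move=> /indI/forall_inP; apply.
exists I; first by move=> u v uI vI; exact: indI.
(* A low-degree vertex neither in [I] nor adjacent to it could be added to [I], against
   maximality. *)
have domI v : v \in L -> exists2 u, u \in I & (v == u) || adj G u v.
  move=> vL; have [vI|vI] := boolP (v \in I); first by exists v; rewrite ?eqxx.
  have [[u /andP[uI uv]]|nadj] := pselect (exists u, (u \in I) && adj G u v).
    by exists u; rewrite ?uv ?orbT.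
  case/negP: vI; rewrite -(maxI (v |: I)%SET) ?setU11 ?finset.subsetUr//.
  apply/andP; split.
    by apply/fintype.subsetP => w /setU1P[->//|]; exact: (fintype.subsetP IL).
  apply/forall_inP => x /setU1P[->|xI]; apply/forall_inP => y /setU1P[->|yI].
  - by rewrite adj_irrefl.
  - by apply/negP => vy; apply: nadj; exists y; rewrite yI adj_sym.
  - by apply/negP => xv; apply: nadj; exists x; rewrite xI.
  - exact: indI.
apply: le_trans L_half _; rewrite mulrCA ler_pM2l ?ltr0n//.
rewrite -sum1_card natr_sum.
(* Double counting: every vertex of [L] is dominated at least once, and each vertex of [I] dominates
   at most 1 + 2D vertices. *)
apply: (@le_trans _ _ (\sum_(v < N) \sum_(u in I) ((v == u) || adj G u v)%:R)).
  rewrite big_mkcond; apply: ler_sum => v _; case: ifP => [/domI[u uI uv]|_].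
    by rewrite (bigD1 u)//= uv lerDl sumr_ge0.
  by rewrite sumr_ge0.
rewrite exchange_big/= -sum1_card natr_sum mulr_suml; apply: ler_sum => u uI.
rewrite -closed_degreeE mul1r lerD2l.
by have /(fintype.subsetP IL) := uI; rewrite inE.
Qed.

(** * Accuracy of the estimate on the typical event *)

Lemma ln_dist_le (R : realType) (m x y : R) : 0 < m -> m <= x -> m <= y ->
  `|ln x - ln y| <= `|x - y| / m.
Proof.
move=> m0; wlog yx : x y / y <= x => [hw mx my|mx my].
  have [/hw|/ltW/hw] := leP y x; first exact.
  by rewrite distrC (distrC x); exact.
have y0 : 0 < y by exact: lt_le_trans my.
have x0 : 0 < x by exact: lt_le_trans mx.
rewrite !ger0_norm ?subr_ge0 ?ler_ln//.
rewrite -ln_div//.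
have -> : x / y = 1 + (x - y) / y by field; rewrite gt_eqF.
apply: (@le_trans _ _ ((x - y) / y)).
  apply: le_ln1Dx; apply: (@lt_le_trans _ _ 0); first by rewrite ltrN10.
  by rewrite divr_ge0 ?subr_ge0 // ltW.
by rewrite ler_wpM2l ?subr_ge0// lef_pV2.
Qed.

Lemma mple_close (R : realType) (beta : R) (N : nat) (G : sgraph 'I_N)
    (s : config N) (M delta : R) : 0 < M -> M ^+ 2 <= N%:R -> 0 < delta ->
  delta * N%:R < (occupied s)%:R ->
  `|(occupied s)%:R - expR beta * (unblocked G s)%:R|
    <= M * delta / 2 * Num.sqrt N%:R ->
  ((Num.sqrt N%:R)%:E * `|mple R G s - beta%:E| <= M%:E)%E.
Proof.
move=> M0 MN d0 c_gt.
set c := (occupied s)%:R in c_gt *; set U := (unblocked G s)%:R.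
set r := Num.sqrt N%:R => S_le.
have rr : r ^+ 2 = N%:R by rewrite sqr_sqrtr.
have r0 : 0 <= r by exact: sqrtr_ge0.
have Mr : M <= r by rewrite -(@ler_pXn2r _ 2) ?nnegrE ?rr // ltW.
have r_gt0 : 0 < r by exact: lt_le_trans Mr.
(* Since M <= sqrt N, the deviation of c from tU is at most m, half the lower bound on c. Hence both
   c and tU are at least m, which excludes the infinite values of [mple] and makes ln Lipschitz with
   constant 1/m there. *)
set m := delta / 2 * r ^+ 2.
have m0 : 0 < m by rewrite !mulr_gt0 ?exprn_gt0.
have S_le_m : M * delta / 2 * r <= m.
  rewrite /m expr2 mulrA ler_wpM2r// -mulrA mulrC ler_wpM2l//.
  by rewrite divr_ge0// ltW.
have cm : m + m <= c by rewrite /m rr; move: c_gt; lra.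
have tUm : m <= expR beta * U.
  by move: S_le; rewrite ler_norml => /andP[_]; lra.
have U0 : 0 < U.
  by rewrite -(pmulr_rgt0 _ (expR_gt0 beta)); exact: lt_le_trans tUm.
rewrite /mple.
have -> : occupied s == 0%N = false.
  by apply/negP => /eqP c0; move: cm; rewrite /c c0; lra.
have -> : unblocked G s == 0%N = false.
  by apply/negP => /eqP u0; move: U0; rewrite /U u0 ltxx.
rewrite -EFinB abse_EFin -EFinM lee_fin -/c -/U.
have c0 : 0 < c by apply: lt_le_trans cm; exact: addr_gt0.
have -> : ln (c / U) - beta = ln c - ln (expR beta * U).
  by rewrite ln_div // lnM ?posrE ?expR_gt0 // expRK; ring.
apply: (@le_trans _ _ (r * ((M * delta / 2 * r) / m))).
  rewrite ler_wpM2l//; apply: le_trans (ln_dist_le m0 _ tUm) _; first by lra.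
  by rewrite ler_wpM2r// invr_ge0 ltW.
suff -> : r * (M * delta / 2 * r / m) = M by [].
by rewrite /m; field; rewrite !gt_eqF.
Qed.

(* [4 * k] bounds the exponential growth rate of [hardcore_Z beta] from below;
   tilting the parameter from [beta] down to [beta - l] bounds, by Chernoff, the
   weight of the configurations with few occupied vertices. *)
Lemma tilted_Z_le (R : realType) (beta k l : R) (N : nat) (G : sgraph 'I_N) :
  expR (beta - l) <= k -> expR (4 * k * N%:R) <= hardcore_Z beta G ->
  expR (k * N%:R) * hardcore_Z (beta - l) G
  <= expR (- (2 * k * N%:R)) * hardcore_Z beta G.
Proof.
move=> lk Zge.
apply: (@le_trans _ _ (expR (- (2 * k * N%:R)) * expR (4 * k * N%:R))); last first.
  by rewrite ler_wpM2l ?expR_ge0.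
rewrite -expRD.
have -> : - (2 * k * N%:R) + 4 * k * N%:R = k * N%:R + N%:R * k by ring.
rewrite expRD ler_wpM2l ?expR_ge0//; apply: le_trans (hardcore_Z_le _ _) _.
by rewrite ler_expR ler_wpM2l.
Qed.

(** * Deviation bound uniform in N and in the graph *)

Lemma hardcore_prob_deviation_le (R : realType) (beta D : R) : 0 < D ->
  exists B : R, forall (N : nat) (G : sgraph 'I_N) (M : R),
    \sum_(u < N) (degree G u)%:R <= N%:R * D -> 0 < M -> M ^+ 2 <= N%:R ->
    hardcore_prob beta G
      (fun s => (M%:E < (Num.sqrt N%:R)%:E * `|mple R G s - beta%:E|)%E)
    <= B / M ^+ 2.
Proof.
move=> D0; set t := expR beta; have t0 : 0 < t by exact: expR_gt0.
(* An independent set of at least N / (2(1 + 2D)) vertices gives Z >= exp(4kN). *)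
pose k := ln (1 + t) / (2 * (1 + 2 * D)) / 4.
have lt0 : 0 < ln (1 + t) by rewrite ln_gt0 // ltrDl.
have k0 : 0 < k by rewrite !divr_gt0 ?mulr_gt0 ?addr_gt0 ?mulr_gt0.
pose l := 1 + `|beta - ln k|.
have l0 : 0 < l by rewrite ltr_wpDr.
have lk : expR (beta - l) <= k.
  rewrite -[leRHS]lnK ?posrE// ler_expR /l.
  by have := ler_norm (beta - ln k); lra.
(* The Chernoff cost exp(l delta N) then equals exp(kN), which the growth of Z absorbs. *)
pose delta := k / l; have d0 : 0 < delta by rewrite divr_gt0.
have ld : l * delta = k by rewrite /delta mulrC divfK ?gt_eqF.
clearbody delta l.
exists (4 * (1 + t) ^+ 2 * (1 + D) / delta ^+ 2 + k^-1) => N G M sumD M0 MN.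
have N0 : 0 < N%:R :> R by apply: lt_le_trans MN; rewrite exprn_gt0.
set Z := hardcore_Z beta G; have Z0 : 0 < Z by exact: hardcore_Z_gt0.
have Zge : expR (4 * k * N%:R) <= Z.
  have [I indI NI] := large_independent_set D0 sumD.
  apply: le_trans (hardcore_Z_ge beta indI).
  rewrite -/t -[1 + t]lnK ?posrE ?addr_gt0// -expRM_natl ler_expR.
  have q0 : 0 < 2 * (1 + 2 * D) by rewrite !(mulr_gt0, addr_gt0).
  have -> : 4 * k * N%:R
    = ln (1 + t) * (N%:R / (2 * (1 + 2 * D))).
    by rewrite /k; field; lra.
  by rewrite [leRHS]mulrC ler_wpM2l ?(ltW lt0)// ler_pdivrMr.
clearbody k.
pose S s := \sum_(u < N) score beta G u s.
pose K := M * delta / 2.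
have K0 : 0 < K by rewrite divr_gt0 ?mulr_gt0.
have KN0 : 0 < K ^+ 2 * N%:R by rewrite mulr_gt0 // exprn_gt0.
(* The indicator of the bad event is dominated by a Chebyshev term plus a Chernoff term: the latter
   is at least 1 when c <= delta N, and otherwise [mple_close] forces |S| >= K sqrt N. *)
have bad_le (s : config N) :
    (M%:E < (Num.sqrt N%:R)%:E * `|mple R G s - beta%:E|)%E ->
  1 <= S s ^+ 2 / (K ^+ 2 * N%:R)
       + expR (k * N%:R) * expR (- l * (occupied s)%:R).
  move=> bad; rewrite -expRD.
  have := leP (occupied s)%:R (delta * N%:R); case=> [c_le|c_gt].
    apply: (@le_trans _ _ (0 + 1)); first by rewrite add0r.
    apply: lerD; first by rewrite divr_ge0 ?sqr_ge0 ?(ltW KN0).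
    rewrite -[leLHS]expR0 ler_expR -ld -mulrA mulNr -mulrBr mulr_ge0 ?subr_ge0 ?(ltW l0)//.
  apply: (@le_trans _ _ (1 + 0)); first by rewrite addr0.
  apply: lerD; last exact: expR_ge0.
  rewrite ler_pdivlMr // mul1r /S sum_score.
  rewrite -[N%:R]sqr_sqrtr// -exprMn -[leRHS]real_normK ?num_real//.
  rewrite ler_pXn2r ?nnegrE ?mulr_ge0 ?sqrtr_ge0 ?(ltW K0) ?(ltW M0) ?(ltW d0)//.
  rewrite leNgt; apply/negP => /ltW S_le.
  have := mple_close M0 MN d0 c_gt S_le.
  by rewrite leNgt bad.
rewrite /hardcore_prob -mulr_suml ler_pdivrMr// -/Z.
apply: (@le_trans _ _ (\sum_(s : config N) hardcore_weight beta G s *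
   (S s ^+ 2 / (K ^+ 2 * N%:R)
       + expR (k * N%:R) * expR (- l * (occupied s)%:R)))).
  rewrite big_mkcond; apply: ler_sum => s _.
  case: ifP => [/bad_le h|_].
    by rewrite ler_peMr// hardcore_weight_ge0.
  rewrite mulr_ge0 ?hardcore_weight_ge0 // addr_ge0 //.
  by rewrite divr_ge0 ?sqr_ge0 ?(ltW KN0).
under eq_bigr do rewrite mulrDr mulrA.
rewrite big_split /= -mulr_suml mulrDl mulrDl; apply: lerD.
  rewrite ler_pdivrMr //.
  apply: le_trans (sum_score_sq _ _) _; rewrite -/Z -/t.
  have : \sum_(u < N) (1 + (degree G u)%:R) <= N%:R * (1 + D) :> R.
    by rewrite big_split /= sumr_const card_ord mulrDr mulr1 lerD2l.
  have P0 : 0 <= (1 + t) ^+ 2 * Z.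
    by rewrite mulr_ge0 ?sqr_ge0// ltW.
  move=> /(ler_wpM2l P0) h; apply: le_trans h _.
  rewrite le_eqVlt; apply/orP; left; apply/eqP; rewrite /K; field.
  by rewrite !gt_eqF.
(* The factor exp(-lc) shifts the parameter of the weight from beta to beta - l. *)
have -> : \sum_(s : config N) hardcore_weight beta G s *
      (expR (k * N%:R) * expR (- l * (occupied s)%:R))
    = expR (k * N%:R) * hardcore_Z (beta - l) G.
  rewrite mulr_sumr; apply: eq_bigr => s _.
  by rewrite !hardcore_weightE mulrDl expRD; ring.
apply: le_trans (tilted_Z_le lk Zge) _; rewrite -/Z ler_wpM2r ?(ltW Z0)//.
(* Exponential decay is traded for 1/(k M^2) through exp(2kN) >= 1 + 2kN and M^2 <= N. *)
rewrite expRN -invfM lef_pV2 ?posrE ?expR_gt0 ?mulr_gt0 ?exprn_gt0//.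
apply: le_trans (expR_ge1Dx _).
have : k * M ^+ 2 <= k * N%:R by rewrite ler_wpM2l// ltW.
have : 0 < k * N%:R by rewrite mulr_gt0.
by lra.
Qed.

(** * The limit superior in N, then the limit in M *)

Lemma limn_esup_le_near (R : realType) (u : (\bar R)^nat) (b : \bar R) :
  (\forall n \near \oo, (u n <= b)%E) -> (limn_esup u <= b)%E.
Proof.
move=> ub; apply: (@le_trans _ _ (ereal_sup [set u n | n in [set n | (u n <= b)%E]])).
  by apply: ereal_inf_lbound; exists [set n | (u n <= b)%E].
by apply: ge_ereal_sup => _ [n /= un <-].
Qed.

Lemma limn_esup_ge0 (R : realType) (u : (\bar R)^nat) :
  (forall n, (0 <= u n)%E) -> (0 <= limn_esup u)%E.
Proof.
move=> u0; apply: le_ereal_inf_tmp => _ [V [n _ nV] <-].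
apply: le_trans (u0 n) _; apply: ereal_sup_ubound; exists n => //.
exact: nV (leqnn n).
Qed.

(* The absence of isolated vertices is required for N >= 2 only, since a graph
   on one vertex always has an isolated vertex. *)
Theorem theorem2p5 (R : realType) (beta : R)
    (G : forall N : nat, sgraph 'I_N)
    (G_no_isolated : forall N : nat, (2 <= N)%N -> no_isolated (G N))
    (G_bounded_avg_degree :
      (ereal_sup [set (@avg_degree R N (G N))%:E | N in [set N : nat | (1 <= N)%N]]
         < +oo)%E) :
  (fun M : R =>
     limn_esup (fun N : nat =>
       (hardcore_prob beta (G N)
          (fun s => (M%:E < (Num.sqrt N%:R)%:E * `|mple R (G N) s - beta%:E|)%E))%:E))
    @ +oo --> 0%E.
Proof.
set A := [set (@avg_degree R N (G N))%:E | N in _] in G_bounded_avg_degree.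
have [D D0 sumD] : exists2 D : R, 0 < D & forall N, (1 <= N)%N ->
    \sum_(u < N) (degree (G N) u)%:R <= N%:R * D.
  have supA N : (1 <= N)%N -> ((avg_degree R (G N))%:E <= ereal_sup A)%E.
    by move=> N1; apply: ereal_sup_ubound; exists N.
  case: (ereal_sup A) G_bounded_avg_degree supA => [D| |] //= _ supA.
    exists (1 + `|D|) => [|N N1]; first by rewrite ltr_wpDr.
    have := supA N N1; rewrite lee_fin /avg_degree mulrC ler_pdivrMr ?ltr0n//.
    move=> /le_trans; apply; rewrite mulrC ler_wpM2l//.
    by have := ler_norm D; lra.
  (* The supremum is not -oo, because the term N = 1 is finite. *)
  by have := supA 1%N isT.
have [B dev] := hardcore_prob_deviation_le beta D0.
apply: (@squeeze_cvge _ _ _ _ (fun=> 0%E) _ (fun M => (B / M ^+ 2)%:E)).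
(* For fixed M > 0 the deviation bound holds as soon as N >= M^2, so the limit superior lies between
   0 and B / M^2. *)
- near=> M; have M0 : 0 < M by near: M; exact: nbhs_pinfty_gt.
  rewrite limn_esup_ge0/=; last first.
    by move=> N; rewrite lee_fin sumr_ge0// => s _; exact: hardcore_pmf_ge0.
  apply: limn_esup_le_near; near=> N; rewrite lee_fin.
  have MN : M ^+ 2 <= N%:R by near: N; exact: nbhs_infty_ger.
  apply: dev => //; apply: sumD; rewrite -(ltr0n R).
  by apply: lt_le_trans MN; rewrite exprn_gt0.
- exact: cvg_cst.
- apply: cvg_EFin; first by near=> M.
  rewrite -[0](mulr0 B); apply: cvgMr; apply/gtr0_cvgV0; last exact: cvgr_expr2.
  by near=> M; rewrite exprn_gt0.
Unshelve. all: by end_near. Qed.
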